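(* (Maximum modulus principle) Let $A\in\{\mathbb{C},\mathbb{H},\mathbb{O}\}$, let $\Omega\subseteq A$ be a circular open set, let $f\in\mathcal{SR}(\Omega)$ and suppose $|f|$ has a local maximum point $x_0\in\Omega$. 1. If $\Omega$ is a slice domain, then $f$ is constant. 2. If $\Omega$ is a product domain and $x_0\in\mathbb{C}_J^+$ (with $J\in\mathbb{S}$), then $f$ is constant in $\Omega_J^+$.
   Context: $A$ is one of the real $*$-algebras $\mathbb{C},\mathbb{H},\mathbb{O}$ (complex numbers, quaternions, octonions), $|\cdot|$ is the Euclidean norm and $A$ has the Euclidean topology; $\mathbb{S}=\{w\in A: w^2=-1\}$. For $J\in\mathbb{S}$, $\mathbb{C}_J=\mathbb{R}+\mathbb{R}J$, $\mathbb{C}_J^+=\{\alpha+\beta J:\alpha,\beta\in\mathbb{R},\beta>0\}$ and $\Omega_J^+=\Omega\cap\mathbb{C}_J^+$. For nonempty $D\subseteq\mathbb{C}$ invariant under complex conjugation, $\Omega_D=\{\alpha+\beta J:\alpha,\beta\in\mathbb{R},\,J\in\mathbb{S},\,\alpha+i\beta\in D\}$; sets of this form are called circular. If $D$ is open, connected and intersects $\mathbb{R}$, $\Omega_D$ is a slice domain; if $D$ is open, does not intersect $\mathbb{R}$ and has two connected components switched by complex conjugation, $\Omega_D$ is a product domain. For $D$ open and $\Omega=\Omega_D$, $\mathcal{SR}(\Omega)$ is the set of slice regular functions: functions $f:\Omega\to A$ for which there are $C^1$ functions $F_1,F_2:D\to A$ with $F_1(\bar z)=F_1(z)$, $F_2(\bar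 z)=-F_2(z)$, $f(\alpha+\beta J)=F_1(\alpha+i\beta)+JF_2(\alpha+i\beta)$ for all $\alpha+i\beta\in D$, $J\in\mathbb{S}$, and $\partial F_1/\partial\alpha=\partial F_2/\partial\beta$, $\partial F_1/\partial\beta=-\partial F_2/\partial\alpha$. *)

(* Defs.v *)
From HB Require Import structures.
From mathcomp Require Import all_boot all_order all_algebra.
From mathcomp Require Import all_classical all_reals all_analysis.

Set Implicit Arguments.
Unset Strict Implicit.
Unset Printing Implicit Defensive.

Import Order.TTheory GRing.Theory Num.Theory.
Import numFieldNormedType.Exports.

Local Open Scope classical_set_scope.
Local Open Scope ring_scope.

(* The k-th Cayley-Dickson algebra over R: CD R 1, CD R 2 and CD R 3 are the
   complex numbers, the quaternions and the octonions. The underlying normed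
   module R ^ (2 ^ k) is only used for its real vector space structure and its
   topology, which is the Euclidean one. Its library norm is a sup norm; the
   Euclidean norm is cd_norm below. *)
Fixpoint CD (R : realType) (k : nat) : normedModType R :=
  if k is k'.+1 then (CD R k' * CD R k')%type else R^o.

Fixpoint cd_one (R : realType) (k : nat) : CD R k :=
  match k return CD R k with
  | 0 => (1 : R)
  | k'.+1 => (cd_one R k', 0)
  end.

Fixpoint cd_conj (R : realType) (k : nat) : CD R k -> CD R k :=
  match k return CD R k -> CD R k with
  | 0 => id
  | k'.+1 => fun x => (cd_conj x.1, - x.2)
  end.

Fixpoint cd_mul (R : realType) (k : nat) : CD R k -> CD R k -> CD R k :=
  match k return CD R k -> CD R k -> CD R k with
  | 0 => fun x y => (x : R) * (y : R)
  | k'.+1 => fun x y =>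
      (cd_mul x.1 y.1 - cd_mul (cd_conj y.2) x.2,
       cd_mul y.2 x.1 + cd_mul x.2 (cd_conj y.1))
  end.

Fixpoint cd_sqnorm (R : realType) (k : nat) : CD R k -> R :=
  match k return CD R k -> R with
  | 0 => fun x => (x : R) ^+ 2
  | k'.+1 => fun x => cd_sqnorm x.1 + cd_sqnorm x.2
  end.

Definition cd_norm (R : realType) (k : nat) (x : CD R k) : R :=
  Num.sqrt (cd_sqnorm x).

(* The complex number alpha + i beta, as a parameter of slice functions, is the
   pair (alpha, beta). *)
Definition plane (R : realType) : normedModType R := (R^o * R^o)%type.

Definition plane_conj (R : realType) (z : plane R) : plane R := (z.1, - z.2).

Section SliceFunctions.
Variables (R : realType) (k : nat).
Local Notation A := (CD R k).

Definition imag_units : set A := [set J | cd_mul J J = - cd_one R k].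

Definition slice_pt (J : A) (z : plane R) : A := z.1 *: cd_one R k + z.2 *: J.

Definition half_slice (J : A) : set A :=
  [set slice_pt J z | z in [set z : plane R | 0 < z.2]].

Definition conj_invariant (D : set (plane R)) : Prop :=
  forall z, D z -> D (plane_conj z).

Definition circularization (D : set (plane R)) : set A :=
  [set x | exists z J, [/\ D z, imag_units J & x = slice_pt J z]].

Definition circular_of (D : set (plane R)) (Om : set A) : Prop :=
  [/\ D !=set0, conj_invariant D & Om = circularization D].

Definition circular (Om : set A) : Prop := exists D, circular_of D Om.

Definition meets_real_line (D : set (plane R)) : Prop :=
  exists2 z, D z & z.2 = 0.

Definition slice_domain (Om : set A) : Prop :=
  exists D, [/\ circular_of D Om, open D, connected D & meets_real_line D].

Definition two_swapped_components (D : set (plane R)) : Prop :=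
  exists U V : set (plane R),
    [/\ [set connected_component D z | z in D] = [set U; V],
        U <> V & @plane_conj R @` U = V].

Definition product_domain (Om : set A) : Prop :=
  exists D, [/\ circular_of D Om, open D, ~ meets_real_line D &
                two_swapped_components D].

Definition d_alpha (F : plane R -> A) : plane R -> A :=
  'D_((1, 0) : plane R) F.

Definition d_beta (F : plane R -> A) : plane R -> A :=
  'D_((0, 1) : plane R) F.

(* F is total, but for D open only its values on D matter. *)
Definition C1_on (D : set (plane R)) (F : plane R -> A) : Prop :=
  forall z, D z ->
    [/\ derivable F z ((1, 0) : plane R), derivable F z ((0, 1) : plane R),
        {for z, continuous (d_alpha F)} & {for z, continuous (d_beta F)}].

Definition stem (D : set (plane R)) (F1 F2 : plane R -> A) : Prop :=
  forall z, D z -> F1 (plane_conj z) = F1 z /\ F2 (plane_conj z) = - F2 z.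

Definition induced_by (D : set (plane R)) (F1 F2 : plane R -> A)
    (f : A -> A) : Prop :=
  forall z J, D z -> imag_units J ->
    f (slice_pt J z) = F1 z + cd_mul J (F2 z).

Definition cauchy_riemann (D : set (plane R)) (F1 F2 : plane R -> A) : Prop :=
  forall z, D z ->
    d_alpha F1 z = d_beta F2 z /\ d_beta F1 z = - d_alpha F2 z.

(* The total function f represents its restriction to Om. *)
Definition slice_regular (Om : set A) (f : A -> A) : Prop :=
  exists D, [/\ circular_of D Om, open D &
    exists F1 F2 : plane R -> A,
      [/\ C1_on D F1, C1_on D F2, stem D F1 F2, induced_by D F1 F2 f &
          cauchy_riemann D F1 F2]].

Definition norm_local_max (Om : set A) (f : A -> A) (x0 : A) : Prop :=
  Om x0 /\ \forall x \near within Om (nbhs x0), cd_norm (f x) <= cd_norm (f x0).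

Definition constant_on (X : set A) (f : A -> A) : Prop :=
  exists c, forall x, X x -> f x = c.

End SliceFunctions.

(* Main.v *)
(* On a slice, [g z := F1 z + J F2 z] is holomorphic for the complex structure
   [x |-> J x] of A, so for every [y] the real functions [<g, y>] and [<g, J y>]
   satisfy the Cauchy-Riemann equations on D. If [|g|] has a local maximum at
   [z0], then so has [<g, g z0>]; the mean value property makes the latter
   locally constant, and Cauchy-Schwarz makes [g] locally constant. The identity
   theorem propagates this along D: a Cauchy-Riemann pair vanishing near [q] can
   be divided arbitrarily often by [(z - q) / r] without losing the
   Cauchy-Riemann equations, so by the maximum principle on a box its modulus is
   bounded by [C (|z - q| / r) ^ n] for all [n] and vanishes on the disc of
   radius [r]. On a slice domain, [g = c] on D forces [F1 = c] and [F2 = 0] by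
   comparing [z] with its conjugate, whence [f = c] on the other slices too. *)
Require Import Defs.
From mathcomp Require Import all_boot all_order all_algebra.
From mathcomp Require Import all_classical all_reals all_analysis.
From mathcomp Require Import ring lra.

Set Implicit Arguments.
Unset Strict Implicit.
Unset Printing Implicit Defensive.
Import Order.TTheory GRing.Theory Num.Theory.
Import numFieldNormedType.Exports.
Local Open Scope classical_set_scope.
Local Open Scope ring_scope.

(** * Cayley-Dickson algebras *)

(** The Euclidean inner product, with quadratic form [cd_sqnorm]. Pairing with fixed vectors reduces
    statements on functions with values in the algebra to statements on real functions. *)
Fixpoint cd_dot (R : realType) (k : nat) : CD R k -> CD R k -> R :=
  match k return CD R k -> CD R k -> R with
  | 0 => fun x y => (x : R) * (y : R)
  | k'.+1 => fun x y => cd_dot x.1 y.1 + cd_dot x.2 y.2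
  end.

Section Algebra.
Variables (R : realType).

Lemma cd_dotC k (x y : CD R k) : cd_dot x y = cd_dot y x.
Proof.
elim: k x y => [|k IH] x y /=; first exact: mulrC.
by rewrite IH [X in _ + X]IH.
Qed.

Lemma cd_dotDl k (x y z : CD R k) :
  cd_dot (x + y) z = cd_dot x z + cd_dot y z.
Proof.
elim: k x y z => [|k IH] x y z /=; first exact: mulrDl.
by rewrite !IH addrACA.
Qed.

Lemma cd_dotZl k c (x y : CD R k) : cd_dot (c *: x) y = c * cd_dot x y.
Proof.
elim: k x y => [|k IH] x y /=; first by rewrite mulrA.
by rewrite !IH mulrDr.
Qed.

Lemma cd_dotNl k (x y : CD R k) : cd_dot (- x) y = - cd_dot x y.
Proof. by rewrite -scaleN1r cd_dotZl mulN1r. Qed.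

Lemma cd_dotNr k (x y : CD R k) : cd_dot x (- y) = - cd_dot x y.
Proof. by rewrite cd_dotC cd_dotNl cd_dotC. Qed.

Lemma cd_dotDr k (x y z : CD R k) :
  cd_dot x (y + z) = cd_dot x y + cd_dot x z.
Proof. by rewrite cd_dotC cd_dotDl !(cd_dotC x). Qed.

Lemma cd_dotxx k (x : CD R k) : cd_dot x x = cd_sqnorm x.
Proof. by elim: k x => [|k IH] x //=; rewrite !IH. Qed.

Lemma cd_sqnorm_ge0 k (x : CD R k) : 0 <= cd_sqnorm x.
Proof.
by elim: k x => [|k IH] x /=; [exact: sqr_ge0 | exact: addr_ge0].
Qed.

Lemma cd_sqnorm_eq0 k (x : CD R k) : cd_sqnorm x = 0 -> x = 0.
Proof.
elim: k x => [|k IH] x /=; first by move/eqP; rewrite sqrf_eq0 => /eqP.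
move=> /eqP; rewrite paddr_eq0 ?cd_sqnorm_ge0// => /andP[/eqP h1 /eqP h2].
by rewrite [x]surjective_pairing (IH _ h1) (IH _ h2).
Qed.

Lemma cd_sqnorm_one k : cd_sqnorm (cd_one R k) = 1.
Proof.
elim: k => [|k IH] /=; first exact: expr1n.
by rewrite IH -cd_dotxx -(scale0r 0) cd_dotZl mul0r addr0.
Qed.

(** The quadratic equation of an element, with trace twice its real part. In real coordinates each
    component is a polynomial identity. *)
Lemma cd_mul_sqr k (x : CD R k) : (1 <= k <= 3)%N ->
  cd_mul x x = (2 * cd_dot (cd_one R k) x) *: x - cd_sqnorm x *: cd_one R k.
Proof.
case: k x => [//|[|[|[|//]]]] x _.
- case: x => a b /=; congr (_, _); rewrite /= ?/GRing.scale /=; ring.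
- case: x => -[a b] [c d] /=; do 2! congr (_, _); rewrite /= ?/GRing.scale /=;
    ring.
- case: x => -[[a b] [c d]] [[e f] [g h]] /=; do 3! congr (_, _);
    rewrite /= ?/GRing.scale /=; ring.
Qed.

(** The adjoint of left multiplication by [x] is left multiplication by the conjugate of [x], which
    is [2 Re x - x]. *)
Lemma cd_dot_mul k (x y z : CD R k) : (1 <= k <= 3)%N ->
  cd_dot (cd_mul x y) z =
  2 * cd_dot (cd_one R k) x * cd_dot y z - cd_dot y (cd_mul x z).
Proof.
case: k x y z => [//|[|[|[|//]]]] x y z _.
- move: x y z => [a1 a2] [b1 b2] [c1 c2] /=. ring.
- move: x y z => [[a1 a2] [a3 a4]] [[b1 b2] [b3 b4]] [[c1 c2] [c3 c4]] /=. ring.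
- move: x => [[[a1 a2] [a3 a4]] [[a5 a6] [a7 a8]]].
  move: y => [[[b1 b2] [b3 b4]] [[b5 b6] [b7 b8]]].
  by move: z => [[[c1 c2] [c3 c4]] [[c5 c6] [c7 c8]]] /=; ring.
Qed.

(** Left alternativity, [x (x y) = (x x) y], combined with the quadratic equation of [x]; it
    replaces associativity in the octonions. *)
Lemma cd_mul_mul k (x y : CD R k) : (1 <= k <= 3)%N ->
  cd_mul x (cd_mul x y) =
  (2 * cd_dot (cd_one R k) x) *: cd_mul x y - cd_sqnorm x *: y.
Proof.
case: k x y => [//|[|[|[|//]]]] x y _.
- move: x y => [a1 a2] [b1 b2]; congr (_, _); rewrite /= ?/GRing.scale /=; ring.
- move: x y => [[a1 a2] [a3 a4]] [[b1 b2] [b3 b4]]; do 2! congr (_, _);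
    rewrite /= ?/GRing.scale /=; ring.
- move: x => [[[a1 a2] [a3 a4]] [[a5 a6] [a7 a8]]].
  move: y => [[[b1 b2] [b3 b4]] [[b5 b6] [b7 b8]]].
  by do 3! congr (_, _); rewrite /= ?/GRing.scale /=; ring.
Qed.
End Algebra.

(** * Cauchy-Riemann pairs in the plane *)

Definition e1 {R : realType} : plane R := (1, 0).
Definition e2 {R : realType} : plane R := (0, 1).

(** * Chain rule along plane curves from continuous partial derivatives *)

Section ChainRule.
Variable R : realType.
Implicit Types (z w : plane R) (u : plane R -> R).

Lemma plane_ballP z w (e : R) :
  ball z e w <-> `|z.1 - w.1| < e /\ `|z.2 - w.2| < e.
Proof. by []. Qed.

Lemma is_derive_line u z (e : plane R) (l t : R) :
  is_derive (t *: e + z) e u l -> is_derive t 1 (fun s : R => u (s *: e + z)) l.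
Proof.
have E : (fun h : R => h^-1 *:
      (((fun s : R => u (s *: e + z)) \o shift t) (h *: 1) - u (t *: e + z))) =
    (fun h => h^-1 *: ((u \o shift (t *: e + z)) (h *: e) - u (t *: e + z))).
  by apply/funext => h /=; rewrite -[h%:A]/(h * 1) mulr1 addrA -scalerDl.
move=> [du Du]; apply: DeriveDef; first by rewrite /derivable E.
by rewrite /derive E.
Qed.

(** Treats both signs of [h] at once, so that coordinate increments need no case distinction
    later. *)
Lemma MVT_dist (f df : R -> R) (h : R) :
  (forall t : R, `|t| <= `|h| -> is_derive t 1 f (df t)) ->
  exists2 c, `|c| <= `|h| & f h - f 0 = df c * h.
Proof.
move=> fd.
have [h0|h0|<-] := ltgtP 0 h; last first.
- by exists 0; rewrite ?subrr ?mulr0.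
- have [|||c] := @MVT_segment _ f df h 0.
  + exact: ltW.
  + move=> x; rewrite in_itv /= => /andP[x1 x2]; apply: fd.
    by rewrite !ltr0_norm// lerN2 ltW.
  + apply: derivable_within_continuous => x; rewrite in_itv /= => /andP[x1 x2].
    apply: ex_derive; apply: fd.
    by rewrite !ler0_norm ?lerN2// ltW.
  + rewrite in_itv /= => /andP[c1 c2] e; exists c.
      by rewrite !ler0_norm ?lerN2// ltW.
    by rewrite -opprB e; ring.
- have [|||c] := @MVT_segment _ f df 0 h.
  + exact: ltW.
  + move=> x; rewrite in_itv /= => /andP[x1 x2]; apply: fd.
    by rewrite !gtr0_norm// ltW.
  + apply: derivable_within_continuous => x; rewrite in_itv /= => /andP[x1 x2].
    apply: ex_derive; apply: fd.
    by rewrite !ger0_norm// ltW.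
  + rewrite in_itv /= => /andP[c1 c2] e; exists c.
      by rewrite !ger0_norm// ltW.
    by rewrite e subr0.
Qed.

(** Go from [z] to [w] through the corner [(z.1, w.2)] and apply the mean value theorem to the
    vertical and the horizontal leg. Both legs stay in every sup-norm ball about [z] that contains
    [w], which later makes [c] and [d] tend to [z]. *)
Lemma plane_mvt u p q z (r : R) w :
  (forall w, ball z r w ->
    is_derive w e1 u (p w) /\ is_derive w e2 u (q w)) ->
  ball z r w ->
  exists c d, [/\ forall e, ball z e w -> ball z e c /\ ball z e d &
    u w - u z = p c * (w.1 - z.1) + q d * (w.2 - z.2)].
Proof.
move=> du zw; have [zw1 zw2] := (plane_ballP z w r).1 zw.
have [s sh hs] : exists2 s, `|s| <= `|w.1 - z.1| &
    u w - u (z.1, w.2) = p (s + z.1, w.2) * (w.1 - z.1).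
  have [|s sh hs] := @MVT_dist (fun t => u (t *: e1 + (z.1, w.2)))
      (fun t => p (t + z.1, w.2)) (w.1 - z.1).
    move=> t ht; apply: is_derive_line.
    have -> : (t *: e1 + (z.1, w.2) : plane R) = (t + z.1, w.2).
      by congr pair; rewrite /= /GRing.scale /=; ring.
    apply: (du _ _).1; apply/plane_ballP; split=> //=.
    by rewrite opprD addrCA subrr addr0 normrN (le_lt_trans ht)// distrC.
  exists s => //; move: hs.
  congr (u _ - u _ = _); [rewrite [w in RHS]surjective_pairing|];
   by congr pair; rewrite /= /GRing.scale /=; ring.
have [t th ht] : exists2 t, `|t| <= `|w.2 - z.2| &
    u (z.1, w.2) - u z = q (z.1, t + z.2) * (w.2 - z.2).
  have [|t th ht] := @MVT_dist (fun t => u (t *: e2 + z))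
      (fun t => q (z.1, t + z.2)) (w.2 - z.2).
    move=> t ht; apply: is_derive_line.
    have -> : (t *: e2 + z : plane R) = (z.1, t + z.2).
      by congr pair; rewrite /= /GRing.scale /=; ring.
    apply: (du _ _).2; apply/plane_ballP; split=> /=.
      by rewrite subrr normr0 (le_lt_trans _ zw1).
    by rewrite opprD addrCA subrr addr0 normrN (le_lt_trans ht)// distrC.
  exists t => //; move: ht.
  congr (u _ - u _ = _); [|rewrite [z in RHS]surjective_pairing];
   by congr pair; rewrite /= /GRing.scale /=; ring.
exists (s + z.1, w.2), (z.1, t + z.2); split; last by rewrite -hs -ht; ring.
move=> e /plane_ballP[we1 we2]; split; apply/plane_ballP; split => //=.
- by rewrite opprD addrCA subrr addr0 normrN (le_lt_trans sh)// distrC.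
- by rewrite subrr normr0 (le_lt_trans _ we1).
- by rewrite opprD addrCA subrr addr0 normrN (le_lt_trans th)// distrC.
Qed.

(** [P] and [Q] are [p] and [q] at the intermediate points of [plane_mvt], which tend to [z] with
    [w]. Having no remainder term, this form of differentiability turns the chain rule into a limit
    of products. *)
Lemma plane_hadamard u p q z :
  (\forall w \near z, is_derive w e1 u (p w) /\ is_derive w e2 u (q w)) ->
  {for z, continuous p} -> {for z, continuous q} ->
  exists P Q : plane R -> R,
   [/\ \forall w \near z, u w - u z = P w * (w.1 - z.1) + Q w * (w.2 - z.2),
       P w @[w --> z] --> p z & Q w @[w --> z] --> q z].
Proof.
move=> /nbhs_ballP[r /= r0 du] pz qz.
have /choice[cd hcd] : forall w, exists cd : plane R * plane R,
    ball z r w ->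
    (forall e, ball z e w -> ball z e cd.1 /\ ball z e cd.2) /\
    u w - u z = p cd.1 * (w.1 - z.1) + q cd.2 * (w.2 - z.2).
  move=> w; have [zw|zw] := pselect (ball z r w); last by exists (z, z).
  by have [c [d [h1 h2]]] := plane_mvt du zw; exists (c, d).
exists (fun w => p (cd w).1), (fun w => q (cd w).2); split.
- by apply/nbhs_ballP; exists r => // w /hcd[].
- apply: (@cvg_comp _ _ _ (fun w => (cd w).1) p _ (nbhs z) _ _ pz).
  apply/cvg_ballP => e e0.
  apply: filterS2 (nbhsx_ballx z r r0) (nbhsx_ballx z e e0) => w zr ze.
  exact: (proj1 ((hcd w zr).1 e ze)).
- apply: (@cvg_comp _ _ _ (fun w => (cd w).2) q _ (nbhs z) _ _ qz).
  apply/cvg_ballP => e e0.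
  apply: filterS2 (nbhsx_ballx z r r0) (nbhsx_ballx z e e0) => w zr ze.
  exact: (proj2 ((hcd w zr).1 e ze)).
Qed.

Lemma is_derive_cvgP (f : R -> R) (t l : R) :
  is_derive t 1 f l <-> (fun h => h^-1 * (f (h + t) - f t)) @ 0^' --> l.
Proof.
have E : (fun h : R => h^-1 *: ((f \o shift t) (h *: 1) - f t)) =
         (fun h => h^-1 * (f (h + t) - f t)).
  by apply/funext => h /=; rewrite -[h%:A]/(h * 1) mulr1.
split=> [[df Df]|fl].
  by move: df Df; rewrite /derivable /derive E => /cvgP df <-.
by apply: DeriveDef; rewrite /derivable /derive E;
  [exact: cvgP fl|exact: cvg_lim].
Qed.

Lemma is_derive_curve u p q (x y : R -> R) (t x' y' : R) :
  (\forall w \near ((x t, y t) : plane R),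
     is_derive w e1 u (p w) /\ is_derive w e2 u (q w)) ->
  {for (x t, y t), continuous p} -> {for (x t, y t), continuous q} ->
  is_derive t 1 x x' -> is_derive t 1 y y' ->
  is_derive t 1 (fun s => u (x s, y s)) (p (x t, y t) * x' + q (x t, y t) * y').
Proof.
move=> du pz qz dx dy.
have [P [Q [uPQ Pp Qq]]] := plane_hadamard du pz qz.
have shift_cvg (f : R -> R) d : is_derive t 1 f d ->
    f (h + t) @[h --> 0^'] --> f t.
  case=> /derivable1_diffP/differentiable_continuous fc _.
  apply: (@cvg_comp _ _ _ (fun h => h + t) f _ (nbhs t) _ _ fc).
  apply: cvg_within_filter;
  have : (h + t) @[h --> (0 : R)] --> 0 + t.
    by apply: cvgD; [exact: cvg_id|exact: cvg_cst].
  by rewrite add0r.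
have cxy : ((x (h + t), y (h + t)) : plane R) @[h --> 0^']
    --> ((x t, y t) : plane R).
  exact: (cvg_pair (shift_cvg _ _ dx) (shift_cvg _ _ dy)).
apply/is_derive_cvgP.
move: dx dy => /is_derive_cvgP dx /is_derive_cvgP dy.
have PX : P (x (h + t), y (h + t)) * (h^-1 * (x (h + t) - x t)) @[h --> 0^']
    --> p (x t, y t) * x'.
  apply: cvgM; last exact: dx.
  exact: (@cvg_comp _ _ _ (fun h => (x (h + t), y (h + t))) P _ _ _ cxy Pp).
have QY : Q (x (h + t), y (h + t)) * (h^-1 * (y (h + t) - y t)) @[h --> 0^']
    --> q (x t, y t) * y'.
  apply: cvgM; last exact: dy.
  exact: (@cvg_comp _ _ _ (fun h => (x (h + t), y (h + t))) Q _ _ _ cxy Qq).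
apply: cvg_trans (cvgD PX QY).
apply: near_eq_cvg.
(* For small [h] the curve stays where the factorization of [u] holds; divided by [h], it is the sum
   of the two products above. *)
have H := cxy _ uPQ; rewrite /nbhs/= in H.
by apply: filterS H => h /= ->; rewrite fctE; ring.
Qed.

End ChainRule.

(** * Mean value property on circles *)

Section MeanValue.
Variable R : realType.
Implicit Types (z w : plane R) (D : set (plane R)) (u v : plane R -> R).

(* [a + i b] is the complex derivative of [u + i v]. *)
Definition cr_on D u v a b := forall z, D z ->
  [/\ is_derive z e1 u (a z) /\ is_derive z e2 u (- b z),
      is_derive z e1 v (b z) /\ is_derive z e2 v (a z),
      {for z, continuous a} & {for z, continuous b}].

Lemma cr_curve D u v a b (x y : R -> R) (t x' y' : R) :
  open D -> cr_on D u v a b -> D (x t, y t) ->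
  is_derive t 1 x x' -> is_derive t 1 y y' ->
  is_derive t 1 (fun s => u (x s, y s))
    (a (x t, y t) * x' - b (x t, y t) * y') /\
  is_derive t 1 (fun s => v (x s, y s)) (b (x t, y t) * x' + a (x t, y t) * y').
Proof.
move=> oD cr Dt dx dy; have [_ _ ca cb] := cr _ Dt.
have near_cr : \forall w \near ((x t, y t) : plane R), D w.
  exact: open_nbhs_nbhs.
split.
  apply: (is_derive_eq (@is_derive_curve _ u a (fun w => - b w) x y t x' y' _ ca
    (continuousN cb) dx dy)); last by ring.
  by apply: filterS near_cr => w /cr[].
apply: is_derive_curve => //.
by apply: filterS near_cr => w /cr[].
Qed.

(** Partial derivatives alone do not give continuity; here they are continuous, and the increment
    factored by [plane_hadamard] tends to 0. *)
Lemma cr_continuous D u v a b : open D -> cr_on D u v a b ->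
  forall z, D z -> {for z, continuous u} /\ {for z, continuous v}.
Proof.
move=> oD cr.
have key (f p q : plane R -> R) z : D z ->
    (forall w, D w -> is_derive w e1 f (p w) /\ is_derive w e2 f (q w)) ->
    {for z, continuous p} -> {for z, continuous q} -> {for z, continuous f}.
  move=> Dz df cp cq.
  have [|P [Q [fPQ Pp Qq]]] := @plane_hadamard _ f p q z _ cp cq.
    by near=> w; apply: df; near: w; exact: open_nbhs_nbhs.
  have c1 : w.1 - z.1 @[w --> z] --> z.1 - z.1.
    by apply: cvgB; [exact: cvg_fst|exact: cvg_cst].
  have c2 : w.2 - z.2 @[w --> z] --> z.2 - z.2.
    by apply: cvgB; [exact: cvg_snd|exact: cvg_cst].
  have S : f z + (P w * (w.1 - z.1) + Q w * (w.2 - z.2)) @[w --> z] -->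
      f z + (p z * (z.1 - z.1) + q z * (z.2 - z.2)).
    by apply: cvgD; [exact: cvg_cst|apply: cvgD; exact: cvgM].
  rewrite !subrr !mulr0 !addr0 in S.
  suff fz : f w @[w --> z] --> f z by exact: fz.
  apply: cvg_trans S. apply: near_eq_cvg; apply: filterS fPQ => w fw.
  by rewrite -fw; ring.
move=> z Dz; have [_ _ ca cb] := cr z Dz; split.
  apply: (key u a (fun w => - b w)) => //; last exact: continuousN.
  by move=> w /cr[].
by apply: (key v b a) => // w /cr[].
Unshelve. all: by end_near. Qed.

(** The radius may be negative, since derivatives in [r] are taken on the symmetric interval []-s,
    s[]. *)
Definition circle (q : plane R) (r t : R) : plane R :=
  (q.1 + r * cos t, q.2 + r * sin t).

Lemma circle_in_ball q (s r t : R) : `|r| < s -> ball q s (circle q r t).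
Proof.
move=> rs; apply/plane_ballP; rewrite /circle /=.
have cs : `|cos t| <= 1 by rewrite ler_norml cos_geN1 cos_le1.
have sn : `|sin t| <= 1 by rewrite ler_norml sin_geN1 sin_le1.
by split; rewrite opprD addrA subrr sub0r normrN normrM;
   rewrite (le_lt_trans _ rs)// ler_piMr.
Qed.

Lemma circle_continuous q (r : R) : continuous (circle q r).
Proof.
move=> t.
have cx : q.1 + r * cos w @[w --> t] --> q.1 + r * cos t.
  by apply: cvgD; [exact: cvg_cst|apply: cvgM;
    [exact: cvg_cst|exact: continuous_cos]].
have cy : q.2 + r * sin w @[w --> t] --> q.2 + r * sin t.
  by apply: cvgD; [exact: cvg_cst|apply: cvgM;
    [exact: cvg_cst|exact: continuous_sin]].
exact: (cvg_pair cx cy).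
Qed.

Lemma circle_comp_continuous (f : plane R -> R) q (r s : R) : `|r| < s ->
  (forall z, ball q s z -> {for z, continuous f}) ->
  continuous (fun t => f (circle q r t)).
Proof.
move=> rs cf t; apply: (@continuous_comp _ _ _ (circle q r) f).
  exact: circle_continuous.
exact/cf/circle_in_ball.
Qed.

Section CircleMean.
Variables (u v a b : plane R -> R) (q : plane R) (s M : R).
Hypothesis cr : cr_on (ball q s) u v a b.
Hypothesis ab_bounded : forall w, ball q s w -> `|a w| <= M /\ `|b w| <= M.

Local Notation circle := (circle q).

Let dx_t (r t : R) : is_derive t 1 (fun t => q.1 + r * cos t) (- (r * sin t)).
Proof.
apply: is_derive_eq; rewrite /GRing.scale /=; ring.
Qed.

Let dy_t (r t : R) : is_derive t 1 (fun t => q.2 + r * sin t) (r * cos t).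
Proof.
apply: is_derive_eq; rewrite /GRing.scale /=; ring.
Qed.

Let dx_r (r t : R) : is_derive r 1 (fun r => q.1 + r * cos t) (cos t).
Proof.
apply: is_derive_eq; rewrite /GRing.scale /=; ring.
Qed.

Let dy_r (r t : R) : is_derive r 1 (fun r => q.2 + r * sin t) (sin t).
Proof.
apply: is_derive_eq; rewrite /GRing.scale /=; ring.
Qed.

(** The radial derivative of [u]: the real part of [(a + i b) e^(i t)]. *)
Let g r t := a (circle r t) * cos t - b (circle r t) * sin t.

Let du_r (r t : R) : `|r| < s ->
  is_derive r 1 (fun r => u (circle r t)) (g r t).
Proof.
move=> rs; apply: (cr_curve (@ball_open _ _ q s) cr _ (dx_r r t) (dy_r r t)).1.
exact: circle_in_ball.
Qed.

(** The Cauchy-Riemann equations in polar form: the angular derivative of [v] is [r] times the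
    radial derivative of [u]. *)
Let dv_t (r t : R) : `|r| < s ->
  is_derive t 1 (fun t => v (circle r t)) (r * g r t).
Proof.
move=> rs.
have -> : r * g r t =
    b (circle r t) * (- (r * sin t)) + a (circle r t) * (r * cos t).
  by rewrite /g; ring.
apply: (cr_curve (@ball_open _ _ q s) cr _ (dx_t r t) (dy_t r t)).2.
exact: circle_in_ball.
Qed.

Let g_continuous r : `|r| < s -> continuous (g r).
Proof.
move=> rs t; apply: cvgB; apply: cvgM.
- by apply: (@circle_comp_continuous a q r s rs) => z /cr[].
- exact: continuous_cos.
- by apply: (@circle_comp_continuous b q r s rs) => z /cr[].
- exact: continuous_sin.
Qed.

Let mu := (@lebesgue_measure R).
Let J : set R := `[- pi, pi].

Let integrableJ (f : R -> R) : continuous f -> mu.-integrable J (EFin \o f).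
Proof.
move=> cf; apply: continuous_compact_integrable; first exact: segment_compact.
by apply: continuous_subspaceT.
Qed.

Let npi_lt_pi : - pi < pi :> R.
Proof. by have := pi_gt0 R; lra. Qed.

(** The circle closes up: [r * g r] is the derivative of [v] along it, and [v] has equal values at
    the angles [- pi] and [pi]. Dividing by [r] excludes the radius 0. *)
Let int_g r : 0 < `|r| < s -> \int[mu]_(t in J) g r t = 0.
Proof.
move=> /andP[r0 rs].
have E : \int[mu]_(t in J) (r * g r t) = 0.
  rewrite /Rintegral (@continuous_FTC2 _ _ (fun t => v (circle r t)))//.
  - by rewrite /circle cosN sinN cospi sinpi oppr0 subee.
  - apply: continuous_subspaceT => t; apply: cvgM; [exact: cvg_cst|].
    exact: g_continuous.
  - split.
    + by move=> t _; apply: ex_derive; exact: dv_t.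
    + apply: cvg_at_right_filter.
      apply: (@circle_comp_continuous v q r s rs) => z.
      by move=> /(cr_continuous (@ball_open _ _ q s) cr)[].
    + apply: cvg_at_left_filter.
      apply: (@circle_comp_continuous v q r s rs) => z.
      by move=> /(cr_continuous (@ball_open _ _ q s) cr)[].
  - by move=> t _; rewrite derive1E; apply: derive_val; exact: dv_t.
move: E; rewrite RintegralZl; first last.
- exact/integrableJ/g_continuous.
- exact: measurable_itv.
by move=> /eqP; rewrite mulf_eq0 -[r == 0]normr_eq0 gt_eqF// => /eqP.
Qed.

Let phi r := \int[mu]_(t in J) u (circle r t).

(** Differentiating [phi] under the integral sign gives the integral of [g], which is 0. So [phi] is
    constant in [r], and [phi 0] is the integral of the constant [u q]. *)
Lemma circle_mean_cst r : 0 <= r < s ->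
  \int[mu]_(t in J) u (circle r t) = \int[mu]_(t in J) u q.
Proof.
move=> /andP[r0 rs].
have s0 : 0 < s by exact: le_lt_trans rs.
have Is (x : R) : `]- s, s[%classic x -> `|x| < s.
  by rewrite /= in_itv /= ltr_norml.
have partial x t : `|x| < s ->
    partial1of2 (fun r t => u (circle r t)) x t = g x t.
  by move=> xs; rewrite partial1of2E; apply: derive_val; exact: du_r.
have intu (x : R) : `]- s, s[%classic x ->
    mu.-integrable J (EFin \o (fun t => u (circle x t))).
  move=> /Is xs; apply: integrableJ.
  apply: (@circle_comp_continuous u q x s xs) => z.
  by move=> /(cr_continuous (@ball_open _ _ q s) cr)[].
have du (x t : R) : `]- s, s[%classic x -> J t ->
    derivable (fun r => u (circle r t)) x 1.
  by move=> /Is xs _; apply: ex_derive; exact: du_r.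
have M0 : 0 <= M.
  by apply: le_trans (ab_bounded (ballxx q s0)).1; exact: normr_ge0.
(* The constant [M + M] dominates the radial derivative, as cosine and sine are bounded by 1. *)
have G0 (y : R) : 0 <= cst (M + M) y by rewrite addr_ge0.
have intG : mu.-integrable J (EFin \o (cst (M + M))).
  by apply: integrableJ => t; exact: cvg_cst.
have G_ub (x t : R) : `]- s, s[%classic x -> J t ->
    `|partial1of2 (fun r t => u (circle r t)) x t| <= cst (M + M) t.
  move=> /Is xs _; rewrite partial//= /g.
  have [aM bM] := ab_bounded (circle_in_ball q t xs).
  have cs : `|cos t| <= 1 by rewrite ler_norml cos_geN1 cos_le1.
  have sn : `|sin t| <= 1 by rewrite ler_norml sin_geN1 sin_le1.
  rewrite (le_trans (ler_normB _ _))// !normrM lerD//.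
    by rewrite -[leRHS]mulr1 ler_pM.
  by rewrite -[leRHS]mulr1 ler_pM.
have dphi (x : R) : 0 < `|x| < s -> is_derive x 1 phi 0.
  move=> /andP[x0 xs].
  have Ix : `]- s, s[%classic x by rewrite /= in_itv /= -ltr_norml.
  apply: DeriveDef.
    exact: (@derivable_under_integral R _ _ mu (fun r t => u (circle r t)) J
      (measurable_itv _) x (- s) s Ix intu du _ G0 intG G_ub).
  rewrite -derive1E.
  rewrite (@differentiation_under_integral R _ _ mu
    (fun r t => u (circle r t)) J
    (measurable_itv _) x (- s) s Ix intu du _ G0 intG G_ub).
  rewrite -[RHS](int_g (r := x)) ?x0//; apply: eq_Rintegral => t _.
  exact: partial.
have derphi (x : R) : `|x| < s -> derivable phi x 1.
  move=> xs; have Ix : `]- s, s[%classic x by rewrite /= in_itv /= -ltr_norml.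
  exact: (@derivable_under_integral R _ _ mu (fun r t => u (circle r t)) J
      (measurable_itv _) x (- s) s Ix intu du _ G0 intG G_ub).
(* The mean value theorem asks for the derivative on the open interval only, so the radius 0 may be
   left out; at 0 continuity suffices, and [derphi] gives it. *)
have [||c _] := @MVT_segment _ phi (cst 0) 0 r r0.
- move=> x; rewrite in_itv /= => /andP[x0 xr]; apply: dphi.
  by rewrite gtr0_norm// x0 (lt_trans xr).
- apply: derivable_within_continuous => x; rewrite in_itv /= => /andP[x0 xr].
  by apply: derphi; rewrite ger0_norm// (le_lt_trans xr).
rewrite mul0r => /eqP; rewrite subr_eq0 => /eqP; rewrite /phi => ->.
apply: eq_Rintegral => t _.
by rewrite /circle !mul0r !addr0 -surjective_pairing.
Qed.

End CircleMean.

End MeanValue.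

(** * Local maxima of the real part *)

Section LocalMaximum.
Variable R : realType.
Implicit Types (z w : plane R) (D : set (plane R)) (u v : plane R -> R).

(** The integral over [[c, y]] lies between 0 and the whole integral, so it vanishes for all inner
    [y]. Its derivative is [h], which is therefore 0 inside; the endpoints follow by continuity. *)
Lemma integral_ge0_eq0 (h : R -> R) (c d : R) : c < d -> continuous h ->
  (forall t, 0 <= h t) -> \int[lebesgue_measure]_(t in `[c, d]) h t = 0 ->
  forall t, c <= t <= d -> h t = 0.
Proof.
move=> cd ch h0 int0.
have inth x y : lebesgue_measure.-integrable `[x, y] (EFin \o h).
  apply: continuous_compact_integrable; first exact: segment_compact.
  exact: continuous_subspaceT.
pose F y := \int[lebesgue_measure]_(t in `[c, y]) h t.
have F0 y : c < y < d -> F y = 0.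
  move=> /andP[cy yd].
  have := @Rintegral_itvB _ h (BLeft c) (BRight d) y (inth c d).
  rewrite int0 !bnd_simp => /(_ (ltW cy) (ltW yd)) E.
  apply/le_anti; rewrite /F Rintegral_ge0// andbT -oppr_ge0 -sub0r E.
  exact: Rintegral_ge0.
have hoo x : c < x < d -> h x = 0.
  move=> /andP[cx xd].
  have [_] := @continuous_FTC1_closed _ h c x d xd (inth c d) cx (ch x).
  move=> <-; rewrite derive1E -[RHS](@derive_cst R R R (0 : R) x 1).
  apply: near_eq_derive.
  near=> y; apply: F0; apply/andP; split; near: y.
    exact: lt_nbhsr.
  exact: lt_nbhsl.
move=> t /andP[ct td].
have [tc|tc] := eqVneq t c.
  apply/eqP; apply: contraT => ht.
  have ht0 : 0 < h t by rewrite lt_def ht h0.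
  near t^'+ => y.
  suff : 0 < h y.
    rewrite hoo ?ltxx//; apply/andP; split; rewrite -?tc; near: y.
      exact: nbhs_right_gt.
    by apply: nbhs_right_lt; rewrite tc.
  near: y; apply: (cvgr_gt (h t)) => //.
  exact/cvg_at_right_filter/ch.
have [tD|tD] := eqVneq t d.
  apply/eqP; apply: contraT => ht.
  have ht0 : 0 < h t by rewrite lt_def ht h0.
  near t^'- => y.
  suff : 0 < h y.
    rewrite hoo ?ltxx//; apply/andP; split; rewrite -?tD; near: y.
      by apply: nbhs_left_gt; rewrite tD.
    exact: nbhs_left_lt.
  near: y; apply: (cvgr_gt (h t)) => //.
  exact/cvg_at_left_filter/ch.
by apply: hoo; rewrite !lt_neqAle ct td tD eq_sym tc.
Unshelve. all: by end_near. Qed.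

(** The angle is [acos (x / r)] up to the sign of [y]. The bound on [r] serves to compare circles
    with sup-norm balls. *)
Lemma polar_coordinates (x y : R) : exists r t : R,
  [/\ 0 <= r, r <= `|x| + `|y|, - pi <= t <= pi, x = r * cos t & y = r * sin t].
Proof.
pose r := Num.sqrt (x ^+ 2 + y ^+ 2).
have r2 : r ^+ 2 = x ^+ 2 + y ^+ 2 by rewrite sqr_sqrtr// addr_ge0 ?sqr_ge0.
have r0 : 0 <= r by exact: sqrtr_ge0.
have pi0 : 0 <= pi :> R by exact: pi_ge0.
have rxy : r <= `|x| + `|y|.
  rewrite -(@ler_pXn2r _ 2) ?nnegrE ?addr_ge0//
    r2 sqrrD !real_normK ?num_real//.
  by rewrite lerD2r lerDl mulrn_wge0// mulr_ge0.
have [r_eq0|r_neq0] := eqVneq r 0.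
  move: r2; rewrite r_eq0 expr0n /= => /esym/eqP.
  rewrite paddr_eq0 ?sqr_ge0// !sqrf_eq0 => /andP[/eqP -> /eqP ->].
  by exists 0, 0; split; rewrite ?mul0r ?normr0 ?addr0 ?oppr_le0 ?pi0.
have rgt0 : 0 < r by rewrite lt_def r_neq0.
have x_r : -1 <= x / r <= 1.
  rewrite -ler_norml normrM normfV (ger0_norm r0) ler_pdivrMr// mul1r.
  rewrite -(@ler_pXn2r _ 2) ?nnegrE// real_normK ?num_real// r2 lerDl.
  exact: sqr_ge0.
have cosE : r * cos (acos (x / r)) = x.
  by rewrite acosK ?in_itv//= mulrC divfK.
have sinE : r * sin (acos (x / r)) = `|y|.
  rewrite sin_acos// -[in X in X * _](ger0_norm r0) -sqrtr_sqr -sqrtrM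
    ?sqr_ge0//.
  rewrite mulrBr mulr1 -exprMn mulrC divfK// r2 addrAC subrr add0r.
  by rewrite sqrtr_sqr.
have acos_itv : 0 <= acos (x / r) <= pi by rewrite acos_ge0// acos_lepi.
move: acos_itv => /andP[t0 tpi].
have [y0|y0] := leP 0 y.
  exists r, (acos (x / r)); split=> //.
    by rewrite tpi andbT; lra.
  by rewrite sinE ger0_norm.
exists r, (- acos (x / r)); split=> //.
- by apply/andP; split; lra.
- by rewrite cosN.
- by rewrite sinN mulrN sinE ltr0_norm// opprK.
Qed.

(** On a small circle about [z] the function [u z - u] is continuous and nonnegative, and its
    integral is 0 by the mean value property; so it vanishes there. Every point near [z] lies on
    such a circle. *)
Lemma cr_local_max D u v a b z : open D -> cr_on D u v a b -> D z ->
  (\forall w \near z, u w <= u z) -> \forall w \near z, u w = u z.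
Proof.
move=> oD cr Dz umax; have [_ _ ca cb] := cr z Dz.
(* The summand 1 leaves strict room, so that by continuity [M] bounds both functions near [z]. *)
pose M := `|a z| + `|b z| + 1.
have aM : \forall w \near z, `|a w| <= M.
  have h : `|a w| @[w --> z] --> `|a z| by exact: cvg_norm.
  near=> w; apply: ltW; near: w; apply: (cvgr_lt _ h).
  by rewrite /M -addrA ltrDl ltr_wpDl.
have bM : \forall w \near z, `|b w| <= M.
  have h : `|b w| @[w --> z] --> `|b z| by exact: cvg_norm.
  near=> w; apply: ltW; near: w; apply: (cvgr_lt _ h).
  by rewrite /M addrAC ltrDr ltr_wpDl.
have zD : \forall w \near z, D w by exact: open_nbhs_nbhs.
have [s /= s0 hs] : exists2 s : R, 0 < s & forall w, ball z s w ->
    [/\ D w, `|a w| <= M, `|b w| <= M & u w <= u z].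
  have /nbhs_ballP[s s0 hs] : \forall w \near z,
      [/\ D w, `|a w| <= M, `|b w| <= M & u w <= u z].
    by near=> w; split; near: w.
  by exists s.
have cr_s : cr_on (ball z s) u v a b by move=> w /hs[/cr].
have ab_s w : ball z s w -> `|a w| <= M /\ `|b w| <= M by move=> /hs[].
(* The radius is halved because the circle through [w] has radius at most the sum of the two
   coordinate distances, each below [s / 2]. *)
apply/nbhs_ballP; exists (s / 2); first by rewrite /= divr_gt0.
move=> w /plane_ballP[w1 w2].
have [r [t [r0 rs tpi e_1 e_2]]] := polar_coordinates (w.1 - z.1) (w.2 - z.2).
have rlt : r < s.
  rewrite (le_lt_trans rs)// [s]splitr ltrD// distrC//.
have E : u (circle z r t) = u w.
  by rewrite /circle -e_1 -e_2 !(addrC z.1, addrC z.2) !subrK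
    -surjective_pairing.
pose f t := u z - u (circle z r t).
have rlt' : `|r| < s by rewrite ger0_norm.
have cu : continuous (fun t => u (circle z r t)).
  by apply: (@circle_comp_continuous _ u z r s rlt') =>
    x /hs[/(cr_continuous oD cr)[]].
have fc : continuous f.
  by move=> x; apply: cvgB; [exact: cvg_cst|exact: cu].
suff : f t = 0 by rewrite /f E => /eqP; rewrite subr_eq0 => /eqP.
apply: (@integral_ge0_eq0 f (- pi) pi) => //.
- by have := pi_gt0 R; lra.
- by move=> x; rewrite subr_ge0; have [] := hs _ (circle_in_ball z x rlt').
- rewrite RintegralB; first last.
  + apply: continuous_compact_integrable; first exact: segment_compact.
    exact: continuous_subspaceT.
  + apply: continuous_compact_integrable; first exact: segment_compact.
    by apply: continuous_subspaceT => x; exact: cvg_cst.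
  + exact: measurable_itv.
  by rewrite (circle_mean_cst cr_s ab_s) ?subrr// r0.
Unshelve. all: by end_near. Qed.

End LocalMaximum.

(** * Maximum principle on a closed square *)

Section MaximumOnBoxes.
Variable R : realType.
Implicit Types (z w : plane R) (D : set (plane R)) (u v : plane R -> R).

Definition box q (r : R) : set (plane R) :=
  [set z | `|z.1 - q.1| <= r /\ `|z.2 - q.2| <= r].

Lemma box_compact q r : compact (box q r).
Proof.
suff -> : box q r = `[q.1 - r, q.1 + r] `*` `[q.2 - r, q.2 + r].
  by apply: compact_setX; exact: segment_compact.
by apply/seteqP; split => z; rewrite /box /= !in_itv /= !ler_distl => -[-> ->].
Qed.

Lemma continuous_on_within (f : plane R -> R) (K : set (plane R)) :
  (forall z, K z -> {for z, continuous f}) -> {within K, continuous f}.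
Proof.
move=> fK; apply: continuous_in_subspaceT => z zK.
by apply: fK; rewrite inE in zK.
Qed.

(** If the maximum over the box exceeded [M], the set [K] where it is attained would avoid the
    boundary. At a rightmost point of [K] the function is locally constant, so [K] would contain
    points further to the right. *)
Lemma cr_max_box D u v a b q r M : open D -> cr_on D u v a b ->
  box q r `<=` D ->
  (forall z, box q r z -> r <= `|z.1 - q.1| \/ r <= `|z.2 - q.2| -> u z <= M) ->
  forall z, box q r z -> u z <= M.
Proof.
move=> oD cr boxD uM z0 z0B; rewrite leNgt; apply/negP => Mz0.
have cu z : D z -> {for z, continuous u} by move=> /(cr_continuous oD cr)[].
have [c] := @compact_EVT_max _ _ u (box q r) (ex_intro _ z0 z0B) 
    (@box_compact q r)
  (continuous_on_within (fun z zB => cu z (boxD z zB))).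
rewrite inE => cB cmax.
have Mc : M < u c by apply: lt_le_trans Mz0 (cmax _ _); rewrite inE.
pose K := box q r `&` [set z | u z = u c].
(* Continuity of [u] is known on [D] only, so compactness of [K] comes from its being relatively
   closed in the box. *)
have KE : K = box q r `&` closure K.
  apply/seteqP; split => z [zB zK]; split=> //; first exact: subset_closure.
  apply/eqP; apply: contraT => uz.
  have /zK[w [[_ uw]]] : \forall w \near z, u w != u c.
    have h : u w - u c @[w --> z] --> u z - u c.
      by apply: cvgB; [exact: (cu z (boxD z zB))|exact: cvg_cst].
    near=> w; rewrite -subr_eq0; near: w.
    by apply: (cvgr_neq0 _ h); rewrite subr_eq0.
  by rewrite uw eqxx.
have cK : compact K.
  by rewrite KE; apply: compact_closedI; 
    [exact: box_compact|exact: closed_closure].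
(* Choose [p] in [K] with the largest first coordinate. *)
have [p] := @compact_EVT_max _ _ (fun z : plane R => z.1) K
  (ex_intro _ c (conj cB erefl)) cK
  (continuous_on_within (fun z _ => cvg_fst)).
rewrite inE => -[pB up] pmax.
have pN1 : `|p.1 - q.1| < r.
  by rewrite ltNge; apply/negP => h; have := uM p pB (or_introl h);
    rewrite up leNgt Mc.
have pN2 : `|p.2 - q.2| < r.
  by rewrite ltNge; apply/negP => h; have := uM p pB (or_intror h);
    rewrite up leNgt Mc.
have pnear : \forall w \near p, box q r w.
  have c1 : `|w.1 - q.1| @[w --> p] --> `|p.1 - q.1|.
    by apply: cvg_norm; apply: cvgB; [exact: cvg_fst|exact: cvg_cst].
  have c2 : `|w.2 - q.2| @[w --> p] --> `|p.2 - q.2|.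
    by apply: cvg_norm; apply: cvgB; [exact: cvg_snd|exact: cvg_cst].
  by near=> w; split; apply: ltW; near: w;
    [exact: (cvgr_lt _ c1)|exact: (cvgr_lt _ c2)].
have /(cr_local_max oD cr (boxD _ pB)) pcst : \forall w \near p, u w <= u p.
  by apply: filterS pnear => w wB; rewrite up; apply: cmax; rewrite inE.
have : \forall w \near p, K w.
  apply: filterS2 pnear pcst => w wB uw.
  by split=> //=; rewrite uw.
move=> /nbhs_ballP[e /= e0 eK].
have e20 : 0 < e / 2 by rewrite divr_gt0.
have /mem_set/pmax /= : K (p.1 + e / 2, p.2).
  apply: eK; apply/plane_ballP; split => /=; last by rewrite subrr normr0.
  by rewrite opprD addrA subrr sub0r normrN gtr0_norm// ltr_pdivrMr// ltr_pMr//
    ltr1n.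
by rewrite gerDl leNgt e20.
Unshelve. all: by end_near. Qed.

End MaximumOnBoxes.

(** * Identity theorem for Cauchy-Riemann pairs *)

Section IdentityTheorem.
Variable R : realType.
Implicit Types (z w : plane R) (D : set (plane R)) (u v : plane R -> R).

Lemma is_derive_linear_comp (V W W' : normedModType R) (L : W -> W')
    (F : V -> W) (x e : V) (l : W) :
  {morph L : y z / y - z} -> (forall k y, L (k *: y) = k *: L y) ->
  continuous L -> is_derive x e F l -> is_derive x e (fun y => L (F y)) (L l).
Proof.
move=> LB LZ Lc [dF DF].
have cF : (fun h => h^-1 *: ((F \o shift x) (h *: e) - F x)) @ 0^' --> l.
  by rewrite -DF; exact: dF.
have cLF : (fun h =>
      h^-1 *: (((fun y => L (F y)) \o shift x) (h *: e) - L (F x)))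
    @ 0^' --> L l.
  under eq_fun do rewrite /= -LB -LZ.
  exact: (cvg_comp _ _ cF (Lc l)).
by apply: DeriveDef; [exact: cvgP cLF|exact: cvg_lim cLF].
Qed.

Lemma is_derive_inv (V : normedModType R) (f : V -> R) (x e : V) (l : R) :
  f x != 0 -> is_derive x e f l ->
  is_derive x e (fun y => (f y)^-1) (- (l / f x ^+ 2)).
Proof.
move=> fx0 [df Df]; apply: DeriveDef; first exact: derivableV.
by rewrite deriveV// Df /GRing.scale /= mulrC mulrN.
Qed.

Lemma is_derive_fst z (e : plane R) (c : R) :
  is_derive z e (fun w : plane R => w.1 - c) e.1.
Proof.
have h : is_derive z e (fun w : plane R => w.1 : R^o) e.1.
  apply: (@is_derive_linear_comp _ _ _ (fun w : plane R => w.1 : R^o) id) => //.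
  by move=> w; exact: cvg_fst.
by apply: is_derive_eq (subr0 _).
Qed.

Lemma is_derive_snd z (e : plane R) (c : R) :
  is_derive z e (fun w : plane R => w.2 - c) e.2.
Proof.
have h : is_derive z e (fun w : plane R => w.2 : R^o) e.2.
  apply: (@is_derive_linear_comp _ _ _ (fun w : plane R => w.2 : R^o) id) => //.
  by move=> w; exact: cvg_snd.
by apply: is_derive_eq (subr0 _).
Qed.

(** Multiplication of [u + i v] by [i]. Iterating it lets a bound for first components apply to [u],
    [v] and their negatives. *)
Lemma cr_rot D u v a b : cr_on D u v a b ->
  cr_on D (fun w => - v w) u (fun w => - b w) a.
Proof.
move=> cr z /cr[[u1 u2] [v1 v2] ca cb]; split=> //; last exact: continuousN.
by split; apply: is_deriveN.
Qed.

(** The complex product [(u + i v) (u' + i v')], whose derivative is given by the Leibniz rule. *)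
Lemma cr_mul D u v a b u' v' a' b' : open D ->
  cr_on D u v a b -> cr_on D u' v' a' b' ->
  cr_on D (fun w => u w * u' w - v w * v' w) (fun w => u w * v' w + v w * u' w)
    (fun w => (a w * u' w - b w * v' w) + (u w * a' w - v w * b' w))
    (fun w => (a w * v' w + b w * u' w) + (u w * b' w + v w * a' w)).
Proof.
move=> oD cr cr' z Dz.
have [cu cv] := cr_continuous oD cr Dz.
have [cu' cv'] := cr_continuous oD cr' Dz.
have [[u1 u2] [v1 v2] ca cb] := cr z Dz.
have [[u1' u2'] [v1' v2'] ca' cb'] := cr' z Dz.
split.
- by split; apply: is_derive_eq; rewrite /GRing.scale /=; ring.
- by split; apply: is_derive_eq; rewrite /GRing.scale /=; ring.
- apply: cvgD; first by apply: cvgB; apply: cvgM.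
  by apply: cvgB; apply: cvgM.
- apply: cvgD; first by apply: cvgD; apply: cvgM.
  by apply: cvgD; apply: cvgM.
Qed.

Definition sqdist q z : R := (z.1 - q.1) ^+ 2 + (z.2 - q.2) ^+ 2.

Lemma sqdist_ge0 q z : 0 <= sqdist q z.
Proof. by rewrite addr_ge0 ?sqr_ge0. Qed.

Lemma sqdist_eq0 q z : (sqdist q z == 0) = (z == q).
Proof.
rewrite paddr_eq0 ?sqr_ge0// !sqrf_eq0 !subr_eq0.
by rewrite [z in RHS]surjective_pairing [q in RHS]surjective_pairing.
Qed.

Lemma continuous_sqdist q : continuous (sqdist q).
Proof.
move=> z; have c1 : w.1 - q.1 @[w --> z] --> z.1 - q.1.
  by apply: cvgB; [exact: cvg_fst|exact: cvg_cst].
have c2 : w.2 - q.2 @[w --> z] --> z.2 - q.2.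
  by apply: cvgB; [exact: cvg_snd|exact: cvg_cst].
by apply: cvgD; rewrite !expr2; [under eq_fun do rewrite expr2|
  under eq_fun do rewrite expr2]; apply: cvgM.
Qed.

(* The holomorphic function r / (z - q). *)
Lemma cr_inv q (r : R) : cr_on [set z | z != q]
  (fun z => r * (z.1 - q.1) / sqdist q z)
  (fun z => - (r * (z.2 - q.2)) / sqdist q z)
  (fun z => - (r * ((z.1 - q.1) ^+ 2 - (z.2 - q.2) ^+ 2)) / sqdist q z ^+ 2)
  (fun z => r * (2 * (z.1 - q.1) * (z.2 - q.2)) / sqdist q z ^+ 2).
Proof.
move=> z /= zq.
have N0 : sqdist q z != 0 by rewrite sqdist_eq0.
have dN e : is_derive z e (sqdist q)
    (2 * (z.1 - q.1) * e.1 + 2 * (z.2 - q.2) * e.2).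
  have d1 := is_derive_fst z e q.1; have d2 := is_derive_snd z e q.2.
  have -> : sqdist q =
    (fun w => w.1 - q.1) ^+ 2 + (fun w => w.2 - q.2) ^+ 2 by [].
  by apply: is_derive_eq; rewrite /GRing.scale /=; ring.
have cX : w.1 - q.1 @[w --> z] --> z.1 - q.1.
  by apply: cvgB; [exact: cvg_fst|exact: cvg_cst].
have cY : w.2 - q.2 @[w --> z] --> z.2 - q.2.
  by apply: cvgB; [exact: cvg_snd|exact: cvg_cst].
have cN2 : (sqdist q w ^+ 2)^-1 @[w --> z] --> (sqdist q z ^+ 2)^-1.
  apply: cvgV; first by rewrite expf_neq0.
  by apply: (@cvg_comp _ _ _ (sqdist q) (fun x : R => x ^+ 2) _ _ _
    (@continuous_sqdist q z)); exact: exprn_continuous.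
have dI e : is_derive z e (fun w => (sqdist q w)^-1)
    (- ((2 * (z.1 - q.1) * e.1 + 2 * (z.2 - q.2) * e.2) / sqdist q z ^+ 2)).
  exact: is_derive_inv.
have dR e : is_derive z e (fun w => r * (w.1 - q.1) / sqdist q w)
   (r * (e.1 / sqdist q z - (z.1 - q.1) *
     ((2 * (z.1 - q.1) * e.1 + 2 * (z.2 - q.2) * e.2) / sqdist q z ^+ 2))).
  have d1 := is_derive_fst z e q.1; have d2 := dI e.
  by apply: is_derive_eq; rewrite /GRing.scale /=; ring.
have dS e : is_derive z e (fun w => - (r * (w.2 - q.2)) / sqdist q w)
   (- (r * (e.2 / sqdist q z - (z.2 - q.2) *
     ((2 * (z.1 - q.1) * e.1 + 2 * (z.2 - q.2) * e.2) / sqdist q z ^+ 2)))).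
  have d1 := is_derive_snd z e q.2; have d2 := dI e.
  by apply: is_derive_eq; rewrite /GRing.scale /=; ring.
have XYN : (z.1 - q.1) ^+ 2 + (z.2 - q.2) ^+ 2 != 0 by [].
split.
- by split; [apply: (is_derive_eq (dR e1))|apply: (is_derive_eq (dR e2))];
    rewrite /sqdist /=; field.
- by split; [apply: (is_derive_eq (dS e1))|apply: (is_derive_eq (dS e2))];
    rewrite /sqdist /=; field.
- apply: cvgM => //; apply: cvgN; apply: cvgM; first exact: cvg_cst.
  by apply: cvgB; exact: cvgM.
- apply: cvgM => //; apply: cvgM; first exact: cvg_cst.
  by apply: cvgM => //; apply: cvgM => //; exact: cvg_cst.
Qed.

Lemma cr_near_zero D u v a b q : open D -> cr_on D u v a b -> D q ->
  (\forall w \near q, u w = 0 /\ v w = 0) ->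
  \forall w \near q, [/\ u w = 0, v w = 0, a w = 0 & b w = 0].
Proof.
move=> oD cr Dq uv0.
near=> w.
have Dw : D w by near: w; exact: open_nbhs_nbhs.
have [u0 v0] : u w = 0 /\ v w = 0 by near: w.
have uvw : \forall x \near w, u x = 0 /\ v x = 0.
  by near: w; exact: nbhs_interior.
have [[u1 _] [v1 _] _ _] := cr w Dw.
have uw : \forall x \near w, u x = cst 0 x by apply: filterS uvw => x [].
have vw : \forall x \near w, v x = cst 0 x by apply: filterS uvw => x [].
split=> //.
  by rewrite -(@derive_val _ _ _ _ _ _ _ u1) (near_eq_derive _ uw) derive_cst.
by rewrite -(@derive_val _ _ _ _ _ _ _ v1) (near_eq_derive _ vw) derive_cst.
Unshelve. all: by end_near. Qed.

(* Division by z - q; the junk value x / 0 = 0 makes the quotient vanish at q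
   itself. *)
Lemma cr_div D u v a b q (r : R) : open D -> cr_on D u v a b -> D q ->
  (\forall w \near q, u w = 0 /\ v w = 0) ->
  exists u' v' a' b',
   [/\ cr_on D u' v' a' b', \forall w \near q, u' w = 0 /\ v' w = 0 &
    forall z, sqdist q z * (u' z ^+ 2 + v' z ^+ 2) =
              r ^+ 2 * (u z ^+ 2 + v z ^+ 2)].
Proof.
move=> oD cr Dq uv0.
have near0 := cr_near_zero oD cr Dq uv0.
have oq : open [set z : plane R | z != q].
  rewrite openE => z zq; rewrite /interior /=.
  near=> w; suff : sqdist q w != 0 by rewrite sqdist_eq0.
  near: w; apply: (cvgr_neq0 _ (@continuous_sqdist q z)).
  by rewrite sqdist_eq0.
have oDq : open (D `&` [set z | z != q]) by exact: openI.
have crq := cr_mul oDq (fun z h => cr z h.1) (fun z h => @cr_inv q r z h.2).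
set u' := (X in cr_on _ X _ _ _) in crq.
set v' := (X in cr_on _ _ X _ _) in crq.
set a' := (X in cr_on _ _ _ X _) in crq.
set b' := (X in cr_on _ _ _ _ X) in crq.
exists u', v', a', b'.
have near0' : \forall w \near q, [/\ u' w = cst 0 w, v' w = cst 0 w,
    a' w = cst 0 w & b' w = cst 0 w].
  apply: filterS near0 => w [u0 v0 a0 b0].
  by rewrite /u' /v' /a' /b' u0 v0 a0 b0; split; rewrite /cst /=; ring.
split.
(* Away from [q] the product rule applies; at [q] all four functions agree with 0 on a
   neighbourhood. *)
- move=> z Dz; have [->|zq] := eqVneq z q; last by apply: crq; split.
  have h (f : plane R -> R) e : (\forall w \near q, f w = cst 0 w) ->
      is_derive q e f 0.
    move=> f0; apply: near_eq_is_derive (is_derive_cst (0 : R) q e).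
    by apply: filterS f0 => w /esym.
  have c0 (f : plane R -> R) : (\forall w \near q, f w = cst 0 w) ->
      {for q, continuous f}.
    move=> f0; have fq : f q = 0 by rewrite (nbhs_singleton f0).
    suff fc : f w @[w --> q] --> f q by exact: fc.
    rewrite fq.
    have c0 : cst (0 : R) w @[w --> q] --> (0 : R) by exact: cvg_cst.
    apply: cvg_trans c0.
    by apply: near_eq_cvg; apply: filterS f0 => w /esym.
  have u0 : \forall w \near q, u' w = cst 0 w by apply: filterS near0' => w [].
  have v0 : \forall w \near q, v' w = cst 0 w by apply: filterS near0' => w [].
  have a0 : \forall w \near q, a' w = cst 0 w by apply: filterS near0' => w [].
  have b0 : \forall w \near q, b' w = cst 0 w by apply: filterS near0' => w [].
  have -> : a' q = 0 by rewrite (nbhs_singleton a0).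
  have -> : b' q = 0 by rewrite (nbhs_singleton b0).
  rewrite oppr0; split; [split; exact: h|split; exact: h|exact: c0|exact: c0].
- by apply: filterS near0' => w [].
- move=> z; have [->|zq] := eqVneq z q.
    have [u0 v0] := nbhs_singleton uv0.
    have [] := nbhs_singleton near0'; rewrite /cst => -> -> _ _.
    by rewrite u0 v0 expr0n /= addr0 !mulr0.
  have XYN : (z.1 - q.1) ^+ 2 + (z.2 - q.2) ^+ 2 != 0.
    by rewrite -/(sqdist q z) sqdist_eq0.
  by rewrite /u' /v' /sqdist; field.
Unshelve. all: by end_near. Qed.

(** Off [q] the quotient is [(r / (z - q)) ^ n (u + i v)]. The modulus identity is stated without
    division, so it also holds at [q]. *)
Lemma cr_div_iter D u v a b q (r : R) n : open D -> cr_on D u v a b -> D q ->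
  (\forall w \near q, u w = 0 /\ v w = 0) ->
  exists u' v' a' b',
   [/\ cr_on D u' v' a' b', \forall w \near q, u' w = 0 /\ v' w = 0 &
    forall z, sqdist q z ^+ n * (u' z ^+ 2 + v' z ^+ 2) =
              (r ^+ 2) ^+ n * (u z ^+ 2 + v z ^+ 2)].
Proof.
move=> oD cr Dq uv0; elim: n => [|n [u1 [v1 [a1 [b1 [cr1 uv1 E1]]]]]].
  by exists u, v, a, b; split.
have [u2 [v2 [a2 [b2 [cr2 uv2 E2]]]]] := @cr_div _ _ _ _ _ _ r oD cr1 Dq uv1.
exists u2, v2, a2, b2; split=> // z.
by rewrite exprSr -mulrA E2 mulrCA E1 mulrA -exprS.
Qed.

(** On the boundary of the box [|z - q|] is at least [r], so dividing [n] times by [(z - q) / r]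
    does not increase the modulus there. The maximum principle carries a bound independent of [n]
    inside; multiplying back gives a geometric sequence tending to 0. *)
Lemma cr_zero_disc D u v a b q (r : R) : open D -> cr_on D u v a b ->
  0 < r -> box q r `<=` D ->
  (\forall w \near q, u w = 0 /\ v w = 0) ->
  forall z, sqdist q z < r ^+ 2 -> u z = 0 /\ v z = 0.
Proof.
move=> oD cr r0 boxD uv0 z zr.
have qB : box q r q by rewrite /box /= !subrr normr0 ltW.
have Dq : D q by exact: boxD.
pose W w := u w ^+ 2 + v w ^+ 2.
have W0 w : 0 <= W w by rewrite addr_ge0 ?sqr_ge0.
have cW w : D w -> {for w, continuous W}.
  move=> Dw; have [cu cv] := cr_continuous oD cr Dw.
  by rewrite /W; under [X in {for w, continuous X}]eq_fun do rewrite !expr2;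
    apply: cvgD; apply: cvgM.
have [c _ cmax] := @compact_EVT_max _ _ W (box q r) (ex_intro _ q qB)
  (@box_compact _ q r) (continuous_on_within (fun w wB => cW w (boxD w wB))).
(* A positive [s] with [W <= s ^+ 2] on the box is enough; adding 1 avoids taking a square root. *)
pose s := W c + 1.
have s0 : 0 < s by rewrite ltr_wpDl.
have Ws w : box q r w -> W w <= s ^+ 2.
  move=> /mem_set/cmax h; rewrite (le_trans h)// /s sqrrD1.
  by have := W0 c; have := sqr_ge0 (W c); lra.
have r2 : 0 < r ^+ 2 by rewrite exprn_gt0.
have bnd w (f g : plane R -> R) n :
    sqdist q w ^+ n * (f w ^+ 2 + g w ^+ 2) = (r ^+ 2) ^+ n * W w ->
    box q r w -> r <= `|w.1 - q.1| \/ r <= `|w.2 - q.2| -> f w <= s.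
  move=> fgE wB wr.
  have sqr_le x : r <= `|x| -> r ^+ 2 <= x ^+ 2.
    by move=> rx; rewrite -[leRHS]real_normK ?num_real// ler_pXn2r ?nnegrE//
      ltW.
  have rN : r ^+ 2 <= sqdist q w.
    by case: wr => /sqr_le h; rewrite (le_trans h)//
      /sqdist ?lerDl ?lerDr sqr_ge0.
  have N0 : 0 < sqdist q w by exact: lt_le_trans rN.
  have fg : f w ^+ 2 + g w ^+ 2 <= W w.
    rewrite -(@ler_pM2l _ (sqdist q w ^+ n)) ?exprn_gt0// fgE ler_wpM2r//.
    by rewrite lerXn2r ?nnegrE ?sqdist_ge0 ?(ltW r2).
  rewrite (le_trans (ler_norm _))// -(@ler_pXn2r _ 2) ?nnegrE ?(ltW s0)//.
  rewrite real_normK ?num_real// (le_trans _ (Ws w wB))// (le_trans _ fg)//.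
  by rewrite lerDl sqr_ge0.
have zB : box q r z.
  by split; rewrite -(@ler_pXn2r _ 2) ?nnegrE ?(ltW r0)//
    real_normK ?num_real//;
    apply: ltW; apply: le_lt_trans zr; rewrite /sqdist ?lerDl ?lerDr sqr_ge0.
have key n : W z <= 2 * s ^+ 2 * (sqdist q z / r ^+ 2) ^+ n.
  have [f [g [a' [b' [cr' fg0 fgE]]]]] := @cr_div_iter _ _ _ _ _ _ r n oD cr Dq
    uv0.
  (* The maximum principle bounds a first component from above. The successive rotations have first
     components [f], [- g], [- f] and [g], so both squares are at most [s ^+ 2]; hence the factor
     2. *)
  have cr1 := cr_rot cr'; have cr2 := cr_rot cr1; have cr3 := cr_rot cr2.
  have f_s : f z <= s.
    apply: (cr_max_box oD cr' boxD) zB => w; exact: bnd (fgE w).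
  have g_s : - g z <= s.
    apply: (cr_max_box oD cr1 boxD) zB => w.
    apply: (bnd w (fun w => - g w) f n).
    by rewrite sqrrN addrC fgE.
  have f_s' : - f z <= s.
    apply: (cr_max_box oD cr2 boxD) zB => w.
    apply: (bnd w (fun w => - f w) (fun w => - g w) n).
    by rewrite !sqrrN fgE.
  have g_s' : - - g z <= s.
    apply: (cr_max_box oD cr3 boxD) zB => w.
    apply: (bnd w (fun w => - - g w) (fun w => - f w) n).
    by rewrite !sqrrN addrC fgE.
  have f2 : f z ^+ 2 <= s ^+ 2 by nra.
  have g2 : g z ^+ 2 <= s ^+ 2 by nra.
  rewrite expr_div_n mulrA ler_pdivlMr ?exprn_gt0// mulrC -/(W z) -fgE mulrC.
  by rewrite ler_wpM2r ?exprn_ge0 ?sqdist_ge0//; lra.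
suff Wz : W z = 0.
  move: Wz => /eqP; rewrite paddr_eq0 ?sqr_ge0// !sqrf_eq0.
  by move=> /andP[/eqP -> /eqP ->].
apply/eqP; apply: contraT => Wz; have {}Wz : 0 < W z by rewrite lt_def Wz W0.
have x_lt1 : `|sqdist q z / r ^+ 2| < 1.
  by rewrite ger0_norm ?divr_ge0 ?sqdist_ge0 ?(ltW r2)// ltr_pdivrMr// mul1r.
have lim0 : 2 * s ^+ 2 * (sqdist q z / r ^+ 2) ^+ n @[n --> \oo]
  --> 2 * s ^+ 2 * 0.
  by apply: cvgM; [exact: cvg_cst|exact: cvg_expr].
rewrite mulr0 in lim0.
near \oo => n.
have := key n; rewrite leNgt => /negP; case.
by near: n; exact: (cvgr_lt _ lim0).
Unshelve. all: by end_near. Qed.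

(** The set [E] of points near which the pair vanishes is nonempty and open. It is closed in [D]
    because [cr_zero_disc], applied at a point of [E] close to a limit point, covers a neighbourhood
    of the latter. *)
Lemma cr_unique_continuation D u v a b q : open D -> connected D ->
  cr_on D u v a b -> D q -> (\forall w \near q, u w = 0 /\ v w = 0) ->
  forall z, D z -> u z = 0 /\ v z = 0.
Proof.
move=> oD cD cr Dq uv0.
pose E := [set z | D z /\ \forall w \near z, u w = 0 /\ v w = 0].
have oE : open E.
  rewrite openE => z [Dz z0]; rewrite /interior; near=> w; split.
    by near: w; exact: open_nbhs_nbhs.
  by near: w; exact: nbhs_interior.
suff ED : E = D by move=> z; rewrite -ED => -[_ /nbhs_singleton].
apply: cD; first by exists q; split.
  by exists E => //; apply/seteqP; split=> z; [move=> zE; split=> //;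
    case: zE|case].
exists (closure E); first exact: closed_closure.
apply/seteqP; split => [z zE|p [Dp pE]].
  by split; [case: zE|exact: subset_closure].
split=> //.
have /nbhs_ballP[e /= e0 eD] : nbhs p D by exact: open_nbhs_nbhs.
(* With [c] at sup distance below [e / 3] from [p], the box of half-side [e / 2] about [c] stays in
   the [e]-ball, as [1/3 + 1/2 < 1], and its inscribed disc contains [p], as [2/9 < 1/4]. *)
have e3 : 0 < e / 3 by rewrite divr_gt0.
have [c [[Dc c0] /plane_ballP[pc1 pc2]]] := pE _ (nbhsx_ballx p (e / 3) e3).
have boxD : box c (e / 2) `<=` D.
  move=> w [w1 w2]; apply: eD; apply/plane_ballP; split.
    by move: (ler_distD c.1 p.1 w.1) w1 pc1; rewrite (distrC w.1); lra.
  by move: (ler_distD c.2 p.2 w.2) w2 pc2; rewrite (distrC w.2); lra.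
have := cr_zero_disc oD cr _ boxD c0; rewrite divr_gt0// => /(_ isT) zero.
have near_p : sqdist c p < (e / 2) ^+ 2.
  have h1 : (p.1 - c.1) ^+ 2 < (e / 3) ^+ 2.
    by rewrite -[ltLHS]real_normK ?num_real// ltr_pXn2r ?nnegrE ?(ltW e3).
  have h2 : (p.2 - c.2) ^+ 2 < (e / 3) ^+ 2.
    by rewrite -[ltLHS]real_normK ?num_real// ltr_pXn2r ?nnegrE ?(ltW e3).
  rewrite /sqdist; nra.
near=> w; apply: zero; near: w.
exact: (cvgr_lt _ (@continuous_sqdist c p)).
Unshelve. all: by end_near. Qed.

End IdentityTheorem.

(** * Slices *)

Section SliceAlgebra.
Variables (R : realType) (k : nat).
Hypothesis hk : (1 <= k <= 3)%N.
Local Notation A := (CD R k).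

Lemma cd_dot_inj (x y : A) : (forall w, cd_dot x w = cd_dot y w) -> x = y.
Proof.
move=> xy; apply/eqP; rewrite -subr_eq0; apply/eqP/cd_sqnorm_eq0.
by rewrite -cd_dotxx cd_dotDl cd_dotNl xy subrr.
Qed.

Lemma cd_sqnormB (x y : A) :
  cd_sqnorm (x - y) = cd_sqnorm x - 2 * cd_dot x y + cd_sqnorm y.
Proof.
rewrite -!cd_dotxx !(cd_dotDl, cd_dotDr, cd_dotNl, cd_dotNr) (cd_dotC y x).
by ring.
Qed.

Variable J : A.
Hypothesis hJ : imag_units J.

(** Write [t] for the real part of [J] and [n] for its squared norm. Pairing the quadratic equation
    [- 1 = 2 t J - n] with [J] gives [t (1 + n) = 0]. *)
Lemma imag_unit_re : cd_dot (cd_one R k) J = 0.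
Proof.
have := cd_mul_sqr J hk; rewrite hJ => /(congr1 (fun x => cd_dot x J)).
rewrite cd_dotNl cd_dotDl cd_dotNl !cd_dotZl cd_dotxx.
set t := cd_dot _ J; have := cd_sqnorm_ge0 J; set n := cd_sqnorm J => n0 E.
have : t * (1 + n) = 0 by lra.
by move=> /eqP; rewrite mulf_eq0 [1 + n == 0]gt_eqF ?ltr_wpDr// orbF => /eqP.
Qed.

Lemma imag_unit_sqnorm : cd_sqnorm J = 1.
Proof.
have := cd_mul_sqr J hk; rewrite hJ imag_unit_re mulr0 scale0r sub0r.
move=> /oppr_inj/(congr1 (fun x => cd_dot x (cd_one R k))).
by rewrite cd_dotZl cd_dotxx cd_sqnorm_one mulr1.
Qed.

(** The real part of [J] is 0, so its conjugate is [- J] and left multiplication by [J] is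
    skew-adjoint. *)
Lemma imag_unit_dot x y : cd_dot (cd_mul J x) y = - cd_dot x (cd_mul J y).
Proof. by rewrite cd_dot_mul// imag_unit_re mulr0 mul0r sub0r. Qed.

Lemma imag_unit_mulK x : cd_mul J (cd_mul J x) = - x.
Proof.
by rewrite cd_mul_mul// imag_unit_re imag_unit_sqnorm mulr0 scale0r sub0r
  scale1r.
Qed.

Lemma imag_unit_mulN x : cd_mul J (- x) = - cd_mul J x.
Proof.
by apply: cd_dot_inj => w; rewrite !(cd_dotNl, imag_unit_dot) opprK.
Qed.

Lemma imag_unit_mul0 : cd_mul J 0 = 0.
Proof.
by apply: cd_dot_inj => w; rewrite imag_unit_dot -(scale0r w) !cd_dotZl !mul0r
  oppr0.
Qed.

Lemma slice_pt_re z : cd_dot (cd_one R k) (slice_pt J z) = z.1.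
Proof.
rewrite /slice_pt cd_dotC cd_dotDl !cd_dotZl cd_dotxx cd_sqnorm_one.
by rewrite [cd_dot J _]cd_dotC imag_unit_re mulr0 mulr1 addr0.
Qed.

Lemma slice_pt_sqnorm z : cd_sqnorm (slice_pt J z) = z.1 ^+ 2 + z.2 ^+ 2.
Proof.
rewrite -cd_dotxx {1}/slice_pt cd_dotDl !cd_dotZl slice_pt_re.
rewrite (cd_dotC J) cd_dotDl !cd_dotZl cd_dotxx imag_unit_re imag_unit_sqnorm.
by rewrite mulr0 mulr1 add0r !expr2.
Qed.

End SliceAlgebra.

(** * Circular sets and their parameter domains *)

Section SliceGeometry.
Variables (R : realType) (k : nat).
Hypothesis hk : (1 <= k <= 3)%N.
Local Notation A := (CD R k).
Implicit Types (D : set (plane R)) (Om : set A) (z w : plane R).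

(** Real part and norm of a point determine the first coordinate and the square of the second. *)
Lemma slice_pt_inj (J J' : A) z z' : imag_units J -> imag_units J' ->
  slice_pt J z = slice_pt J' z' -> z = z' \/ z = plane_conj z'.
Proof.
move=> hJ hJ' E.
have z1 : z.1 = z'.1 by rewrite -(slice_pt_re hk hJ) E slice_pt_re.
have : z.1 ^+ 2 + z.2 ^+ 2 = z'.1 ^+ 2 + z'.2 ^+ 2.
  by rewrite -(slice_pt_sqnorm hk hJ) E slice_pt_sqnorm.
rewrite z1 => /addrI/eqP; rewrite eqf_sqr => /orP[/eqP z2|/eqP z2];
  [left|right].
  by rewrite [z]surjective_pairing z1 z2 -surjective_pairing.
by rewrite [z]surjective_pairing z1 z2.
Qed.

(** A point determines its parameter only up to conjugation, and [D] is invariant under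
    conjugation. *)
Lemma circular_of_slice D Om (J : A) z : circular_of D Om -> imag_units J ->
  D z <-> Om (slice_pt J z).
Proof.
move=> [_ Dconj ->] hJ; split=> [Dz|[z' [J' [Dz' hJ' E]]]];
  first by exists z, J.
have [->|->] := slice_pt_inj hJ hJ' E; [exact: Dz'|exact: Dconj].
Qed.

(** Slice regularity and the type of the domain each bring their own parameter set; this identifies
    the two. *)
Lemma circular_of_unique D D' Om : Om !=set0 ->
  circular_of D Om -> circular_of D' Om -> D = D'.
Proof.
move=> [x Omx] cD cD'.
have [J hJ] : exists J : A, imag_units J.
  by case: cD => _ _ E; move: Omx; rewrite E => -[z [J []]]; exists J.
apply/seteqP; split=> z Dz.
  exact/(circular_of_slice z cD' hJ)/(circular_of_slice z cD hJ).
exact/(circular_of_slice z cD hJ)/(circular_of_slice z cD' hJ).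
Qed.

Lemma slice_pt_continuous (J : A) : continuous (slice_pt J).
Proof.
move=> z; by apply: cvgD; apply: cvgZr_tmp; [exact: cvg_fst|exact: cvg_snd].
Qed.

End SliceGeometry.

(** * The upper half of a product domain *)

Section UpperHalf.
Variable R : realType.
Implicit Types (D : set (plane R)) (z w : plane R).

Definition upper D : set (plane R) := D `&` [set z | 0 < z.2].

Lemma upper_open D : open D -> open (upper D).
Proof.
move=> oD; apply: openI => //.
rewrite openE => z z0; rewrite /interior /=.
by near=> w; near: w; apply: (cvgr_gt _ (cvg_snd : w.2 @[w --> z] --> z.2)).
Unshelve. all: by end_near. Qed.

(** The second coordinates of a component form an interval; with a positive and a nonpositive value
    it would contain 0. *)
Lemma component_upper D z : ~ meets_real_line D -> D z -> 0 < z.2 ->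
  connected_component D z `<=` upper D.
Proof.
move=> nR Dz z0 w wC.
have CD := @connected_component_sub _ D z.
split; first exact: CD.
rewrite /= ltNge; apply/negP => w0.
have /connected_intervalP itvC :
    connected ((fun w : plane R => w.2) @` connected_component D z).
  apply: connected_continuous_connected; first exact: component_connected.
  by apply: continuous_subspaceT => x; exact: cvg_snd.
have [x xC x0] : ((fun w : plane R => w.2) @` connected_component D z) 0.
  apply: (itvC w.2 z.2); [by exists w|exists z => //|by rewrite w0 ltW].
  exact: connected_component_refl.
by apply: nR; exists x => //; exact: CD.
Qed.

(** Two upper points in different components would have these swapped by conjugation, which sends
    upper points to lower ones; so a nonempty upper part is a single component. *)
Lemma upper_connected D : ~ meets_real_line D -> two_swapped_components D ->
  connected (upper D).
Proof.
move=> nR [U [V [compE UV UVconj]]].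
have [[z [Dz z0]]|ne] := pselect (upper D !=set0); last first.
  by move/set0P/negP/negPn/eqP : ne => ->; exact: connected0.
have comp w : D w -> connected_component D w = U \/ connected_component D w = V.
  by move=> Dw; have : [set U; V] (connected_component D w) by rewrite -compE;
    exists w.
suff -> : upper D = connected_component D z by exact: component_connected.
apply/seteqP; split; last exact: component_upper.
move=> w [Dw w0] /=.
have zC : connected_component D z z by exact: connected_component_refl.
have wC : connected_component D w w by exact: connected_component_refl.
have disj x y : D x -> 0 < x.2 -> D y -> 0 < y.2 ->
    @plane_conj R @` connected_component D x = connected_component D y -> False.
  move=> Dx x0 Dy y0 E.
  have : connected_component D y (plane_conj x).
    by rewrite -E; exists x => //; exact: connected_component_refl.
  by move=> /(component_upper nR Dy y0)[_] /=; rewrite oppr_gt0 ltNge (ltW x0).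
have [zU|zV] := comp z Dz; have [wU|wV] := comp w Dw.
- by rewrite zU -wU.
- by case: (disj z w) => //; rewrite zU wV.
- by case: (disj w z) => //; rewrite wU zV.
- by rewrite zV -wV.
Qed.

End UpperHalf.

(** * Maximum principle on one slice *)

Section SliceFunctionTheory.
Variables (R : realType) (k : nat).
Hypothesis hk : (1 <= k <= 3)%N.
Local Notation A := (CD R k).
Implicit Types (D : set (plane R)) (F : plane R -> A) (z w : plane R).

Lemma continuous_cd_dot (y : A) : continuous (fun x : A => cd_dot x y : R^o).
Proof.
clear hk; elim: k y => [|n IH] y x /=.
  by apply: cvgM; [exact: cvg_id|exact: cvg_cst].
apply: cvgD.
  apply: (@continuous_comp _ _ _ (fun x : CD R n.+1 => x.1)
    (fun x => cd_dot x y.1 : R^o)).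
    exact: cvg_fst.
  exact: IH.
apply: (@continuous_comp _ _ _ (fun x : CD R n.+1 => x.2)
  (fun x => cd_dot x y.2 : R^o)).
  exact: cvg_snd.
exact: IH.
Qed.

Lemma is_derive_cd_dot F z (e : plane R) (l y : A) : is_derive z e F l ->
  is_derive z e (fun w => cd_dot (F w) y) (cd_dot l y).
Proof.
apply: (@is_derive_linear_comp _ _ _ R^o (fun x : A => cd_dot x y : R^o) F).
- by move=> u v; rewrite cd_dotDl cd_dotNl.
- by move=> c u; rewrite cd_dotZl.
- exact: continuous_cd_dot.
Qed.

Lemma continuous_at_cd_dot F z (y : A) : {for z, continuous F} ->
  {for z, continuous (fun w => cd_dot (F w) y)}.
Proof.
move=> cF; apply: (@continuous_comp _ _ _ F (fun x => cd_dot x y : R^o)) => //.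
exact: continuous_cd_dot.
Qed.

Section OneSlice.
Variables (J : A) (hJ : imag_units J).
Variables (D : set (plane R)) (F1 F2 : plane R -> A).
Hypothesis C1F1 : C1_on D F1.
Hypothesis C1F2 : C1_on D F2.
Hypothesis CR : cauchy_riemann D F1 F2.

Let g z := F1 z + cd_mul J (F2 z).

(* The components of g along y and J y are conjugate harmonic functions, because
   g is holomorphic for the complex structure x |-> J x. *)
Lemma slice_cr (y : A) : cr_on D
  (fun z => cd_dot (g z) y) (fun z => cd_dot (g z) (cd_mul J y))
  (fun z => cd_dot (d_alpha F1 z) y - cd_dot (d_alpha F2 z) (cd_mul J y))
  (fun z => cd_dot (d_alpha F1 z) (cd_mul J y) + cd_dot (d_alpha F2 z) y).
Proof.
have uE : (fun z => cd_dot (g z) y) =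
    (fun z => cd_dot (F1 z) y - cd_dot (F2 z) (cd_mul J y)).
  by apply/funext => z; rewrite /g cd_dotDl imag_unit_dot.
have vE : (fun z => cd_dot (g z) (cd_mul J y)) =
    (fun z => cd_dot (F1 z) (cd_mul J y) + cd_dot (F2 z) y).
  by apply/funext => z; rewrite /g cd_dotDl imag_unit_dot// imag_unit_mulK//
    cd_dotNr opprK.
rewrite uE vE => z Dz.
have [d11 d12 c11 c12] := C1F1 Dz; have [d21 d22 c21 c22] := C1F2 Dz.
have [CR1 CR2] := CR Dz.
have D11 x := is_derive_cd_dot x (derivableP d11).
have D12 x := is_derive_cd_dot x (derivableP d12).
have D21 x := is_derive_cd_dot x (derivableP d21).
have D22 x := is_derive_cd_dot x (derivableP d22).
rewrite -/(d_alpha F1 z) -/(d_beta F1 z) -/(d_alpha F2 z) -/(d_beta F2 z) in D11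
  D12 D21 D22.
split.
- split; first exact: is_deriveB.
  apply: (is_derive_eq (is_deriveB (D12 _) (D22 _))).
  by rewrite CR2 -CR1 cd_dotNl; ring.
- split; first exact: is_deriveD.
  apply: (is_derive_eq (is_deriveD (D12 _) (D22 _))).
  by rewrite CR2 -CR1 cd_dotNl; ring.
- by apply: cvgB; exact: continuous_at_cd_dot.
- by apply: cvgD; exact: continuous_at_cd_dot.
Qed.

Lemma cr_subr (u v a b : plane R -> R) (c d : R) : cr_on D u v a b ->
  cr_on D (fun z => u z - c) (fun z => v z - d) a b.
Proof.
move=> cr z /cr[[u1 u2] [v1 v2] ca cb]; split=> //; split;
  exact: (is_derive_eq (is_deriveB _ (is_derive_cst _ _ _)) (subr0 _)).
Qed.

(** With [c = g z0], expanding [|g - c|^2 >= 0] near [z0] gives [<g, c> <= |c|^2], so [<g, c>] has a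
    local maximum and is locally constant. The same expansion then yields [|g - c|^2 <= 0]. *)
Lemma slice_max z0 : open D -> connected D -> D z0 ->
  (\forall z \near z0, cd_sqnorm (g z) <= cd_sqnorm (g z0)) ->
  forall z, D z -> g z = g z0.
Proof.
move=> oD cD Dz0 gmax; set c := g z0.
have u_c : \forall z \near z0, cd_dot (g z) c = cd_dot (g z0) c.
  apply: (cr_local_max oD (slice_cr c) Dz0).
  apply: filterS gmax => z gz.
  have := cd_sqnorm_ge0 (g z - c); rewrite cd_sqnormB [cd_dot (g z0) c]cd_dotxx
    -/c.
  by move: gz; rewrite -/c; lra.
have g_c : \forall z \near z0, g z = c.
  apply: filterS2 gmax u_c => z gz uz.
  apply/eqP; rewrite -subr_eq0; apply/eqP/cd_sqnorm_eq0/le_anti.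
  rewrite cd_sqnorm_ge0 andbT cd_sqnormB uz [cd_dot (g z0) c]cd_dotxx -/c.
  by move: gz; rewrite -/c; lra.
(* For each [y] the pair of components of [g - c] along [y] and [J y] vanishes near [z0], hence on
   all of [D]. *)
move=> z Dz; apply: cd_dot_inj => y.
have [|+ _] := cr_unique_continuation oD cD
  (cr_subr (cd_dot c y) (cd_dot c (cd_mul J y)) (slice_cr y)) Dz0 _ Dz.
  by apply: filterS g_c => w ->; rewrite !subrr.
by move=> /eqP; rewrite subr_eq0 => /eqP.
Qed.

End OneSlice.

End SliceFunctionTheory.

(** * Maximum modulus on slice domains and product domains *)

Theorem theorem5p1 (R : realType) (k : nat) (hk : (1 <= k <= 3)%N)
    (Om : set (CD R k)) (f : CD R k -> CD R k) (x0 : CD R k)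
    (hcirc : circular Om) (hopen : open Om)
    (hf : slice_regular Om f) (hmax : norm_local_max Om f x0) :
  (slice_domain Om -> constant_on Om f) /\
  (product_domain Om ->
     forall J : CD R k, imag_units J -> half_slice J x0 ->
       constant_on (Om `&` half_slice J) f).
Proof.
have [Omx0 fmax] := hmax.
have [D [cD oD [F1 [F2 [C1F1 C1F2 stemF fE CR]]]]] := hf.
have Om0 : Om !=set0 by exists x0.
(* The local maximum pulls back along the continuous parametrization of the slice through [x0];
   norms are replaced by their squares. *)
have gmax J z0 : imag_units J -> D z0 -> x0 = slice_pt J z0 ->
    \forall z \near z0, cd_sqnorm (F1 z + cd_mul J (F2 z)) <=
                        cd_sqnorm (F1 z0 + cd_mul J (F2 z0)).
  move=> hJ Dz0 x0E.
  have Dnear : \forall z \near z0, D z by exact: open_nbhs_nbhs.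
  have : \forall z \near z0, Om (slice_pt J z) ->
      cd_norm (f (slice_pt J z)) <= cd_norm (f x0).
    have cJ : slice_pt J z @[z --> z0] --> x0.
      by rewrite x0E; exact: slice_pt_continuous.
    exact: (cJ _ fmax).
  apply: filterS2 Dnear => z Dz h.
  have /h : Om (slice_pt J z) by exact/(circular_of_slice hk z cD hJ).
  by rewrite x0E !fE// /cd_norm ler_sqrt// cd_sqnorm_ge0.
split.
- move=> [D' [cD' _ coD' _]].
  have E := circular_of_unique hk Om0 cD' cD; rewrite E in coD'.
  have [z0 [J [Dz0 hJ x0E]]] : circularization D x0 by case: cD => _ _ <-.
  have gc := slice_max hk hJ C1F1 C1F2 CR oD coD' Dz0 (gmax _ _ hJ Dz0 x0E).
  set c := F1 z0 + _ in gc.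
  (* At [z] and its conjugate the constant [c] equals [F1 z + J F2 z] and [F1 z - J F2 z]. Hence
     [J F2 z = 0], and another multiplication by [J] gives [F2 z = 0]. *)
  have Fc z : D z -> F1 z = c /\ F2 z = 0.
    move=> Dz; have Dz' : D (plane_conj z) by case: cD => _ /(_ _ Dz).
    have := gc _ Dz'; have [-> ->] := stemF _ Dz.
    rewrite imag_unit_mulN// => c2; have c1 := gc _ Dz.
    have JF0 : cd_mul J (F2 z) = 0.
      have : 2%:R *: cd_mul J (F2 z) = 0.
        rewrite scaler_nat mulr2n -[RHS](subrr c) -{1}c1 -c2 opprD opprK.
        by rewrite addrACA subrr add0r.
      by move=> /eqP; rewrite scaler_eq0 pnatr_eq0 /= => /eqP.
    split; first by rewrite -c1 JF0 addr0.
    by apply: oppr_inj; rewrite -(imag_unit_mulK hk hJ) JF0 imag_unit_mul0//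
      oppr0.
  exists c => x; have [_ _ ->] := cD => -[z [J' [Dz hJ' ->]]].
  by rewrite fE//; have [-> ->] := Fc z Dz; rewrite imag_unit_mul0// addr0.
- move=> [D' [cD' _ nR twoD']] J hJ [z0 /= z0pos x0E].
  have E := circular_of_unique hk Om0 cD' cD; rewrite E in nR twoD'.
  have Dz0 : D z0 by apply/(circular_of_slice hk z0 cD hJ); rewrite x0E.
  (* All conditions on [F1] and [F2] used by [slice_max] are pointwise and restrict to the connected
     open set [upper D]. *)
  have up (F : plane R -> CD R k) : C1_on D F -> C1_on (upper D) F.
    by move=> C1F z [/C1F].
  have upCR : cauchy_riemann (upper D) F1 F2 by move=> z [/CR].
  have gc := slice_max hk hJ (up _ C1F1) (up _ C1F2) upCR (upper_open oD)
    (upper_connected nR twoD') (conj Dz0 z0pos) (gmax _ _ hJ Dz0 (esym x0E)).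
  exists (F1 z0 + cd_mul J (F2 z0)) => x [Omx [z /= zpos xE]].
  have Dz : D z by apply/(circular_of_slice hk z cD hJ); rewrite xE.
  by rewrite -xE fE// gc.
Qed.
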